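(* The following problem is undecidable: given $d\ge1$ and finitely many matrices $M_1,\dots,M_k\in\mathbb{Q}^{d\times d}$, decide whether the semigroup generated by $M_1,\dots,M_k$ under matrix multiplication (the set of all products $M_{i_1}\cdots M_{i_s}$ with $s\ge1$) contains a matrix all of whose entries are non-negative. *)

(* Defs.v *)
From mathcomp Require Import all_boot all_order all_algebra.
Set Implicit Arguments. Unset Strict Implicit. Unset Printing Implicit Defensive.
Import Order.TTheory GRing.Theory Num.Theory.

Inductive instr : Type :=
  | Inc of nat
  | Dec of nat & nat.

Definition program := seq instr.

Record config := Config { pc : nat; regs : nat -> nat }.

Definition upd (f : nat -> nat) (r v : nat) : nat -> nat :=
  fun x => if x == r then v else f x.

Definition step (P : program) (c : config) : config :=
  match nth (Inc 0) P (pc c) with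
  | Inc r => Config (pc c).+1 (upd (regs c) r (regs c r).+1)
  | Dec r j => if regs c r == 0 then Config j (regs c)
               else Config (pc c).+1 (upd (regs c) r (regs c r).-1)
  end.

Definition halted (P : program) (c : config) : bool := size P <= pc c.

Definition step' (P : program) (c : config) : config :=
  if halted P c then c else step P c.

Definition init_config (input : nat) : config :=
  Config 0 (fun r => if r == 0 then input else 0).

Definition halts_with (P : program) (input o : nat) : Prop :=
  exists t : nat, let c := iter t (step' P) (init_config input) in
                  halted P c /\ regs c 0 = o.

Definition decides (A : Type) (enc : A -> nat) (D Q : A -> Prop) (P : program) : Prop :=
  forall x, D x -> (Q x -> halts_with P (enc x) 1) /\ (~ Q x -> halts_with P (enc x) 0).

Definition undecidable (A : Type) (enc : A -> nat) (D Q : A -> Prop) : Prop :=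
  forall P : program, ~ decides enc D Q P.

Definition cpair (a b : nat) : nat := ((a + b) * (a + b).+1) %/ 2 + b.  (* Cantor pairing *)

Fixpoint code_list (l : seq nat) : nat :=
  match l with [::] => 0 | x :: l' => (cpair x (code_list l')).+1 end.

Definition code_int (z : int) : nat :=
  match z with Posz n => n.*2 | Negz n => n.*2.+1 end.

Definition code_rat (q : rat) : nat := cpair (code_int (numq q)) (code_int (denq q)).

Definition code_mx (d : nat) (M : 'M[rat]_d) : nat :=
  code_list [seq code_rat (M i j) | i <- enum 'I_d, j <- enum 'I_d].

Definition instance := {d : nat & seq 'M[rat]_d}.

Definition code_instance (x : instance) : nat :=
  cpair (projT1 x) (code_list (map (@code_mx (projT1 x)) (projT2 x))).

Definition mxprod (d : nat) (s : seq 'M[rat]_d) : 'M[rat]_d :=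
  (foldr (fun X Y => X *m Y) 1%:M s)%R.

Definition in_semigroup (d : nat) (Ms : seq 'M[rat]_d) (A : 'M[rat]_d) : Prop :=
  exists s : seq 'M[rat]_d, s != [::] /\ all (fun X => X \in Ms) s /\ A = mxprod s.

Definition nonneg_mx (d : nat) (A : 'M[rat]_d) : Prop := forall i j, (0 <= A i j)%R.

Definition semigroup_has_nonneg (x : instance) : Prop :=
  exists A, in_semigroup (projT2 x) A /\ nonneg_mx A.

Definition valid_instance (x : instance) : Prop := (1 <= projT1 x)%N.

(* Main.v *)
Require Import Defs.
From mathcomp Require Import all_boot all_order all_algebra.
From HB Require Import structures.
Set Implicit Arguments. Unset Strict Implicit. Unset Printing Implicit Defensive.
Import Order.TTheory GRing.Theory Num.Theory.

(** A row vector [(q, o1, o2, s, c x^T x)], with [x] the state of a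
    nondeterministic machine with affine updates and equality guards, is
    transformed linearly by each transition: [x^T x] becomes [A^T x^T x A], and
    [s] decreases by [c] times the sum of the squared guard defects.  Hence
    [s >= 0] at the end iff all guards held.  The start matrix has a single
    nonzero row, and only its entry [(0, 0)] depends on the input [n]; every
    non-final matrix makes [o1 = - q < 0], and the final matrix sets
    [o1 = - o2] to the difference between slot 4 of the state and [n] (up to a
    positive factor).  So the semigroup contains a nonnegative matrix iff the
    machine accepts with [n] in slot 4.

    Given a decision program [P], the machine guesses [n], computes the code of
    the instance with parameter [n], simulates [P] on it and accepts iff [P]
    answers 0.  Taking for [n] the code of all matrices but the start matrix,
    which do not depend on [n], makes the instance refer to itself, and [P]
    errs on it. *)

(** * Nondeterministic machines with affine updates and equality guards *)

(** A linear form with natural coefficients is a multiset of slots: [:: 2; 0; 0]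
    stands for [f 2 + f 0 + f 0].  Slot 0 always holds 1, so it gives constants. *)
Definition slots := seq nat.
Definition trans : Type := (seq (slots * slots) * seq (nat * slots))%type.

Definition ev (f : nat -> nat) (l : slots) : nat := sumn (map f l).

(** Assignments are simultaneous; the first pair listed for a slot wins, and an unlisted slot keeps
    its value. *)
Definition subst_of (u : seq (nat * slots)) (j : nat) : slots :=
  foldr (fun p l => if p.1 == j then p.2 else l) [:: j] u.

Definition guard_ok (gs : seq (slots * slots)) (f : nat -> nat) : bool :=
  all (fun g => ev f g.1 == ev f g.2) gs.

Definition exec (u : seq (nat * slots)) (f : nat -> nat) : nat -> nat :=
  fun j => ev f (subst_of u j).

Definition start_state : nat -> nat := fun i => i == 0.

Inductive reach (ts : seq trans) : (nat -> nat) -> Prop :=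
  | reach_start : reach ts start_state
  | reach_step (f : nat -> nat) (t : trans) :
      reach ts f -> t \in ts -> guard_ok t.1 f -> reach ts (exec t.2 f).

Definition bounded (D : nat) (l : slots) : bool := all (fun i => i < D) l.

Definition wf_guards D (gs : seq (slots * slots)) : bool :=
  all (fun g => bounded D g.1 && bounded D g.2) gs.

Definition wf_trans D (t : trans) : bool :=
  wf_guards D t.1 && all (fun p => bounded D p.2) t.2.

Lemma bounded_subst_of D u j :
  j < D -> all (fun p => bounded D p.2) u -> bounded D (subst_of u j).
Proof.
move=> jD; elim: u => [|[i l] u IH] /=; first by rewrite /bounded /= jD.
by case/andP=> lD /IH; case: ifP.
Qed.

(** * Transitions as rational matrices *)

Local Open Scope ring_scope.

Section Encoding.

Variable D' : nat.
Local Notation D := D'.+1.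
Local Notation dim := (4 + D * D)%N.

Definition coef_col (l : slots) : 'cV[rat]_D := \col_i (count_mem (i : nat) l)%:R.

Definition state_row (f : nat -> nat) : 'rV[rat]_D := \row_i (f i)%:R.

Lemma state_row_coef f l :
  bounded D l -> (state_row f *m coef_col l) 0 0 = (ev f l)%:R.
Proof.
rewrite mxE /ev; elim: l => [_|a l IH /= /andP[aD /IH {}IH]] /=.
  by rewrite big1 // => i _; rewrite !mxE mulr0.
rewrite natrD -IH (eq_bigr (fun i : 'I_D =>
  state_row f 0 i * (a == i)%:R + state_row f 0 i * coef_col l i 0)); last first.
  by move=> i _; rewrite !mxE natrD mulrDr.
rewrite big_split /=; congr (_ + _).
rewrite (bigD1 (Ordinal aD)) //= !mxE /= eqxx mulr1 big1 ?addr0 // => i.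
by rewrite eq_sym -val_eqE /= => /negbTE->; rewrite mulr0.
Qed.

Definition guard_col (g : slots * slots) : 'cV[rat]_D := coef_col g.1 - coef_col g.2.

Definition update_mx (u : seq (nat * slots)) : 'M[rat]_D :=
  \matrix_(i, j) coef_col (subst_of u j) i 0.

Lemma state_row_update u f : all (fun p => bounded D p.2) u ->
  state_row f *m update_mx u = state_row (exec u f).
Proof.
move=> uD; apply/rowP=> j; rewrite [RHS]mxE -state_row_coef; last first.
  exact: bounded_subst_of.
by rewrite !mxE; apply: eq_bigr => i _; rewrite !mxE.
Qed.

(** A quadratic condition on the state [x] becomes linear in [W = x^T x], so a matrix can evaluate
    it. *)
Definition penalty (gs : seq (slots * slots)) (W : 'M[rat]_D) : rat :=
  \sum_(g <- gs) ((guard_col g)^T *m W *m guard_col g) 0 0.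

Definition square (f : nat -> nat) : 'M[rat]_D := (state_row f)^T *m state_row f.

Lemma penalty_linear gs a W W' :
  penalty gs (a *: W + W') = a * penalty gs W + penalty gs W'.
Proof.
rewrite /penalty mulr_sumr -big_split /=; apply: eq_bigr => g _.
by move: (guard_col g) => c; rewrite mulmxDr mulmxDl -scalemxAr -scalemxAl !mxE.
Qed.

Lemma penalty_scale gs a W : penalty gs (a *: W) = a * penalty gs W.
Proof.
have p0 : penalty gs 0 = 0.
  by rewrite /penalty big1 // => g _; rewrite mulmx0 mul0mx mxE.
by rewrite -[a *: W]addr0 penalty_linear p0 addr0.
Qed.

(** For a guard column [c], [c^T x^T x c] is the square of the scalar [x c], the defect of that
    guard. *)
Lemma penalty_square gs f : wf_guards D gs ->
  penalty gs (square f) = \sum_(g <- gs) ((ev f g.1)%:R - (ev f g.2)%:R) ^+ 2.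
Proof.
move=> wf; rewrite /penalty [LHS]big_seq [RHS]big_seq; apply: eq_bigr => g.
move=> /(allP wf)/andP[g1 g2].
have gE : (state_row f *m guard_col g) 0 0 = (ev f g.1)%:R - (ev f g.2)%:R.
  by rewrite mulmxBr -!state_row_coef // [LHS]mxE; congr (_ + _); rewrite [LHS]mxE.
rewrite /square !mulmxA -trmx_mul -mulmxA.
by rewrite mxE big_ord1 [X in X * _]mxE gE expr2.
Qed.

Lemma penalty_square_ge0 gs f : wf_guards D gs -> 0 <= penalty gs (square f).
Proof. by move=> wf; rewrite penalty_square // sumr_ge0 // => g _; rewrite sqr_ge0. Qed.

Lemma penalty_square_eq0 gs f : wf_guards D gs ->
  (penalty gs (square f) == 0) = guard_ok gs f.
Proof.
move=> wf; rewrite penalty_square // psumr_eq0; last by move=> g _; rewrite sqr_ge0.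
by apply: eq_all => g /=; rewrite sqrf_eq0 subr_eq0 eqr_nat.
Qed.

Lemma square_update u f : all (fun p => bounded D p.2) u ->
  (update_mx u)^T *m square f *m update_mx u = square (exec u f).
Proof.
by move=> uD; rewrite /square mulmxA -trmx_mul -mulmxA !state_row_update.
Qed.

Definition pack (q o1 o2 s : rat) (W : 'M[rat]_D) : 'rV[rat]_dim :=
  row_mx (\row_(i < 4) [:: q; o1; o2; s]`_i) (mxvec W).

Definition unpack (v : 'rV[rat]_dim) (i : nat) : rat := lsubmx v 0 (inord i : 'I_4).
Definition unpackW (v : 'rV[rat]_dim) : 'M[rat]_D := vec_mx (rsubmx v).

Lemma pack_linear a q o1 o2 s W q' o1' o2' s' W' :
  pack (a * q + q') (a * o1 + o1') (a * o2 + o2') (a * s + s') (a *: W + W') =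
  a *: pack q o1 o2 s W + pack q' o1' o2' s' W'.
Proof.
rewrite /pack scale_row_mx add_row_mx linearP; congr row_mx.
by apply/rowP; case=> [[|[|[|[|//]]]] ?]; rewrite !mxE.
Qed.


Lemma pack_scale a q o1 o2 s W :
  pack (a * q) (a * o1) (a * o2) (a * s) (a *: W) = a *: pack q o1 o2 s W.
Proof.
have pack0 : pack 0 0 0 0 0 = 0.
  rewrite /pack linear0 -row_mx0; congr row_mx.
  by apply/rowP; case=> [[|[|[|[|//]]]] ?]; rewrite !mxE.
by rewrite -[RHS]addr0 -pack0 -pack_linear !addr0.
Qed.

Lemma unpack_pack q o1 o2 s W i :
  (i < 4)%N -> unpack (pack q o1 o2 s W) i = [:: q; o1; o2; s]`_i.
Proof. by move=> i4; rewrite /unpack /pack row_mxKl mxE inordK. Qed.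

Lemma unpackW_pack q o1 o2 s W : unpackW (pack q o1 o2 s W) = W.
Proof. by rewrite /unpackW /pack row_mxKr mxvecK. Qed.

Lemma unpack_linear a u v i : unpack (a *: u + v) i = a * unpack u i + unpack v i.
Proof. by rewrite /unpack linearP !mxE. Qed.

Lemma unpackW_linear a u v : unpackW (a *: u + v) = a *: unpackW u + unpackW v.
Proof. by rewrite /unpackW !linearP. Qed.

Lemma pack00 q o1 o2 s W : pack q o1 o2 s W 0 0 = q.
Proof.
rewrite /pack (_ : 0 = lshift (D * D) (0 : 'I_4)); last exact: val_inj.
by rewrite row_mxEl mxE.
Qed.

Definition trans_fun (t : trans) (v : 'rV[rat]_dim) : 'rV[rat]_dim :=
  pack (unpack v 0) (- unpack v 0) 0 (unpack v 3 - penalty t.1 (unpackW v))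
       ((update_mx t.2)^T *m unpackW v *m update_mx t.2).

(** Since slot 0 holds 1, entry [(0, 4)] of [c x^T x] is [c] times slot 4. The square is then
    erased, so a second final matrix without a restart gets [e = - q < 0]. *)
Definition final_fun (gs : seq (slots * slots)) (v : 'rV[rat]_dim) : 'rV[rat]_dim :=
  let e := unpackW v 0 (inord 4) - unpack v 0 in
  pack (unpack v 0) e (- e) (unpack v 3 - penalty gs (unpackW v)) 0.

Lemma trans_fun_linear t : linear (trans_fun t).
Proof.
move=> a u v; rewrite /trans_fun -pack_linear !unpack_linear unpackW_linear.
rewrite penalty_linear mulmxDr mulmxDl -scalemxAr -scalemxAl mulr0 addr0.
by congr pack; rewrite ?opprD ?mulrN // mulrBr addrACA.
Qed.

Lemma final_fun_linear gs : linear (final_fun gs).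
Proof.
move=> a u v; rewrite /final_fun /= -pack_linear !unpack_linear unpackW_linear.
rewrite penalty_linear scaler0 addr0 !mxE.
by congr pack; rewrite ?mulrN ?mulrBr ?opprD ?opprK // addrACA.
Qed.

HB.instance Definition _ t :=
  GRing.isLinear.Build rat 'rV[rat]_dim 'rV[rat]_dim *:%R (trans_fun t) (trans_fun_linear t).
HB.instance Definition _ gs :=
  GRing.isLinear.Build rat 'rV[rat]_dim 'rV[rat]_dim *:%R (final_fun gs) (final_fun_linear gs).

Definition trans_mx (t : trans) : 'M[rat]_dim := lin1_mx (trans_fun t).
Definition final_mx (gs : seq (slots * slots)) : 'M[rat]_dim := lin1_mx (final_fun gs).

Definition start_row (n : nat) : 'rV[rat]_dim :=
  pack n%:R (-1) 0 0 (square start_state).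

(** A rank-one matrix: it sends a row [v] to [v 0 0] times [start_row n], so a restart forgets all
    but the scale [q]. *)
Definition start_mx (n : nat) : 'M[rat]_dim := delta_mx 0 (0 : 'I_1) *m start_row n.

Lemma mul_pack_trans q o1 o2 s W t :
  pack q o1 o2 s W *m trans_mx t =
  pack q (- q) 0 (s - penalty t.1 W) ((update_mx t.2)^T *m W *m update_mx t.2).
Proof. by rewrite mul_rV_lin1 /= /trans_fun !unpack_pack // unpackW_pack. Qed.

Lemma mul_pack_final q o1 o2 s W gs :
  pack q o1 o2 s W *m final_mx gs =
  pack q (W 0 (inord 4) - q) (q - W 0 (inord 4)) (s - penalty gs W) 0.
Proof. by rewrite mul_rV_lin1 /= /final_fun !unpack_pack // unpackW_pack opprB. Qed.

Lemma mul_row_start (v : 'rV[rat]_dim) n : v *m start_mx n = v 0 0 *: start_row n.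
Proof.
rewrite /start_mx mulmxA -colE [v 0 0](_ : _ = col 0 v 0 0); last by rewrite mxE.
by rewrite [X in X *m _]mx11_scalar mul_scalar_mx.
Qed.

Lemma start_row_tail n j : j != 0 -> start_row n 0 j = start_row 0 0 j.
Proof.
move=> j0; rewrite /start_row /pack !mxE; case: splitP => // k jk; rewrite !mxE.
case: k jk => [[|k] ?] //= jk; case/eqP: j0; exact: val_inj.
Qed.

Lemma start_mx_split n i j :
  start_mx n i j = if (i == 0) && (j == 0) then n%:R else start_mx 0 i j.
Proof.
have smE m : start_mx m i j = (i == 0)%:R * start_row m 0 j.
  by rewrite /start_mx mxE big_ord1 mxE eqxx andbT.
rewrite !smE; case: (i == 0); rewrite ?mul0r // !mul1r.
by case: eqVneq => [->|/start_row_tail//]; rewrite /start_row pack00.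
Qed.

Definition nonneg_row (v : 'rV[rat]_dim) := forall j, 0 <= v 0 j.

Lemma nonneg_pack q o1 o2 s W : nonneg_row (pack q o1 o2 s W) ->
  [/\ 0 <= o1, 0 <= o2 & 0 <= s].
Proof.
move=> nn; have nni i : (i < 4)%N -> 0 <= [:: q; o1; o2; s]`_i.
  by move=> i4; rewrite -(@unpack_pack q o1 o2 s W) // /unpack mxE.
by split; [apply: (nni 1%N) | apply: (nni 2%N) | apply: (nni 3%N)].
Qed.


(** * Nonnegative products and accepting runs *)

Section Acceptance.

Variables (ts : seq trans) (gs : seq (slots * slots)) (n : nat).
Hypotheses (ts_wf : all (wf_trans D) ts) (gs_wf : wf_guards D gs).
Hypotheses (n_gt0 : (0 < n)%N) (D_gt4 : (4 < D)%N).

Definition machine_mxs : seq 'M[rat]_dim := rcons (map trans_mx ts) (final_mx gs).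

Definition accepts : Prop :=
  exists f, [/\ reach ts f, guard_ok gs f & (f 0 * f 4)%N = n].

(* The scalar c is only positive once the start matrix has been used, and then
   q = n c; so [o1, o2 >= 0] at the end compares slot 4 with n. *)
Definition tracked (v : 'rV[rat]_dim) : Prop :=
  exists q o1 o2 s c f, [/\ v = pack q o1 o2 s (c *: square f), 0 < q, 0 <= c, s <= 0
    & s = 0 -> c = 0 \/ q = n%:R * c /\ reach ts f].

(** Start and transition matrices leave [o1 = - q < 0], so only a final matrix can produce a
    nonnegative row. *)
Lemma tracked_mul v X : tracked v -> X \in start_mx n :: machine_mxs ->
  tracked (v *m X) /\ (nonneg_row (v *m X) -> accepts).
Proof.
case=> [q [o1 [o2 [s [c [f [-> q0 c0 s0 sc]]]]]]].
rewrite inE mem_rcons inE => /or3P[/eqP->|/eqP->|/mapP[t tts ->]].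
- rewrite mul_row_start pack00 /start_row.
  have -> : q *: pack n%:R (-1) 0 0 (square start_state) =
      pack (n%:R * q) (- q) 0 0 (q *: square start_state).
    by rewrite -pack_scale !mulr0 mulrN1 mulrC.
  split; last by case/nonneg_pack; rewrite oppr_ge0 leNgt q0.
  exists (n%:R * q), (- q), 0, 0, q, start_state; split=> //.
  - by rewrite mulr_gt0 // ltr0n.
  - exact: ltW.
  - by move=> _; right; split=> //; apply: reach_start.
- rewrite mul_pack_final penalty_scale.
  have p0 := penalty_square_ge0 f gs_wf.
  have cp0 := mulr_ge0 c0 p0.
  split.
    exists q, ((c *: square f) 0 (inord 4) - q), (q - (c *: square f) 0 (inord 4)).
    exists (s - c * penalty gs (square f)), 0, f; split => //.
    - by rewrite scale0r.
    - by rewrite subr_le0 (le_trans s0).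
    - by left.
  have -> : (c *: square f) 0 (inord 4) = c * (f 0 * f 4)%:R.
    by rewrite !mxE big_ord1 !mxE natrM inordK.
  case/nonneg_pack; rewrite !subr_ge0 => le1 le2 le3.
  (* Both [s] and minus the penalty are at most 0, so a nonnegative sum forces both to vanish. *)
  have cp_eq0 : c * penalty gs (square f) = 0.
    by apply/le_anti; rewrite cp0 (le_trans le3).
  have s_eq0 : s = 0 by apply/le_anti; rewrite s0 -[0]cp_eq0.
  have qE : q = c * (f 0 * f 4)%:R by apply/le_anti; rewrite le1 le2.
  have cn0 : c != 0 by apply: contraTneq q0 => cz; rewrite qE cz mul0r ltxx.
  case: (sc s_eq0) => [/eqP|[qn rf]]; first by rewrite (negPf cn0).
  exists f; split=> //.
    by rewrite -(penalty_square_eq0 f gs_wf) -(mulrI_eq0 _ (mulfI cn0)) cp_eq0.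
  by apply/eqP; rewrite -(eqr_nat rat) -(inj_eq (mulfI cn0)) -qE qn mulrC.
- have /andP[wg wu] := allP ts_wf _ tts.
  rewrite mul_pack_trans penalty_scale -scalemxAr -scalemxAl square_update //.
  have p0 := penalty_square_ge0 f wg.
  have cp0 := mulr_ge0 c0 p0.
  split; last by case/nonneg_pack; rewrite oppr_ge0 leNgt q0.
  exists q, (- q), 0, (s - c * penalty t.1 (square f)), c, (exec t.2 f); split=> //.
    by rewrite subr_le0 (le_trans s0).
  move/eqP; rewrite subr_eq0 => /eqP sE.
  have s_eq0 : s = 0 by apply/le_anti; rewrite s0 sE cp0.
  case: (sc s_eq0) => [->|[qn rf]]; [by left|].
  (* A zero scale stays zero until a restart; otherwise the vanishing penalty means that the guards
     of [t] held. *)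
  case: (eqVneq c 0) => [->|cn0]; [by left|right].
  split=> //; apply: reach_step => //.
  by rewrite -(penalty_square_eq0 f wg) -(mulrI_eq0 _ (mulfI cn0)) -sE s_eq0.
Qed.

Lemma tracked_prod v s : tracked v -> s != [::] ->
  all (fun X => X \in start_mx n :: machine_mxs) s ->
  nonneg_row (v *m mxprod s) -> accepts.
Proof.
move=> + + + ; elim: s v => // X [|Y s] IH v tv _ /= /andP[Xin sin].
  by rewrite mulmx1; case: (tracked_mul tv Xin).
by rewrite mulmxA; apply: IH => //; case: (tracked_mul tv Xin).
Qed.

Lemma mxprod_rcons (s : seq 'M[rat]_dim) X : mxprod (rcons s X) = mxprod s *m X.
Proof.
rewrite /mxprod; elim: s => [|Y s IH] /=; first by rewrite mulmx1 mul1mx.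
by rewrite IH mulmxA.
Qed.

(** Along a run all penalties vanish, so [s] stays 0 with scale 1. The value [o] is [-1] for the
    empty run and [- n] afterwards. *)
Lemma reach_prod f : reach ts f ->
  exists s, all (fun X => X \in start_mx n :: machine_mxs) s /\
    exists o, start_row n *m mxprod s = pack n%:R o 0 0 (square f).
Proof.
elim=> [|{}f t rf [s [sin [o sE]]] tts tg].
  by exists [::]; split=> //; exists (-1); rewrite /mxprod /= mulmx1.
have /andP[wg wu] := allP ts_wf _ tts.
exists (rcons s (trans_mx t)); split.
  by rewrite all_rcons sin inE mem_rcons inE map_f ?orbT.
exists (- n%:R); rewrite mxprod_rcons mulmxA sE mul_pack_trans square_update //.
by move: tg; rewrite -(penalty_square_eq0 f wg) => /eqP->; rewrite subr0.
Qed.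

Theorem semigroup_has_nonneg_accepts :
  semigroup_has_nonneg (existT _ dim (start_mx n :: machine_mxs)) <-> accepts.
Proof.
split=> [[A [[s [s0 [sin ->]]] nnA]]|[f [rf gf fn]]].
  apply: (@tracked_prod (delta_mx 0 0) s) => //; last first.
    by move=> j; rewrite -rowE mxE; apply: nnA.
  (* The unit row [e_0], which extracts row 0 of the product, is tracked with [q = 1] and
     [c = 0]. *)
  exists 1, 0, 0, 0, 0, start_state; split=> //; last by move=> _; left.
  rewrite scale0r /pack linear0.
  apply/rowP=> j; rewrite !mxE (_ : (j == 0) = (j == 0 :> nat)) //=.
  case: splitP => k jk; rewrite !mxE jk //.
  by case: k {jk} => [[|[|[|[|//]]]] ?].
have [s [sin [o sE]]] := reach_prod rf.
set w := start_mx n :: rcons s (final_mx gs).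
have win : all (fun X => X \in start_mx n :: machine_mxs) w.
  by rewrite /= mem_head all_rcons sin inE mem_rcons mem_head orbT.
exists (mxprod w); split; first by exists w.
have -> : mxprod w = delta_mx 0 (0 : 'I_1) *m (start_row n *m mxprod s *m final_mx gs).
  rewrite -[mxprod w]/(start_mx n *m mxprod (rcons s (final_mx gs))).
  by rewrite mxprod_rcons /start_mx !mulmxA.
rewrite sE mul_pack_final.
have -> : square f 0 (inord 4) = n%:R.
  by rewrite !mxE big_ord1 !mxE inordK // -natrM fn.
have /eqP-> : penalty gs (square f) == 0 by rewrite penalty_square_eq0.
rewrite !subrr.
(* Row 0 is now [(n, 0, ..., 0)], and the factor [delta_mx] makes all other rows zero. *)
move=> i j; rewrite mxE big_ord1; apply: mulr_ge0; first by rewrite mxE ler0n.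
rewrite /pack linear0 mxE; case: splitP => k _; rewrite mxE //.
by case: k => [[|[|[|[|//]]]] ?] /=; rewrite ?ler0n.
Qed.

End Acceptance.

(** * The code of the start matrix as a function of its parameter *)

(** These entries are the same for every parameter, so parameter 0 represents them all. *)
Definition start_tail : nat :=
  code_list (behead [seq code_rat (start_mx 0 i j) | i <- enum 'I_dim, j <- enum 'I_dim]).

Lemma code_start_mx n : code_mx (start_mx n) = (cpair (cpair n.*2 2) start_tail).+1.
Proof.
(* The integer [n] has numerator [n] and denominator 1, coded by [n.*2] and 2. *)
have e0 : cpair n.*2 2 = code_rat (start_mx n 0 0).
  by rewrite start_mx_split !eqxx /= /code_rat (_ : n%:R = (n : int)%:~R) // numq_int denq_int.
rewrite e0 /code_mx /start_tail enum_ordSl /=; congr (cpair _ (code_list _)).+1.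
congr (_ ++ _).
  apply/eq_in_map=> j /mapP[j' _ ->]; congr code_rat.
  by rewrite start_mx_split andbC -val_eqE.
congr flatten; apply/eq_in_map=> i /mapP[i' _ ->].
by congr cons; [|apply/eq_in_map=> j _]; rewrite start_mx_split -val_eqE.
Qed.

End Encoding.

Local Close Scope ring_scope.

(** * Simulation of counter programs by guarded affine transitions *)

Arguments ev : simpl never.
Arguments bounded : simpl never.

(** [cpair a b] is [tri (a + b) + b]: affine once [tri (a + b)] is available. *)
Definition tri (k : nat) : nat := (k * k.+1) %/ 2.

Lemma triS k : tri k.+1 = tri k + k.+1.
Proof.
have e : k.+1 * k.+2 = k.+1 * 2 + k * k.+1.
  by rewrite -addn2 mulnDr addnC [k * _]mulnC addnC.
by rewrite /tri e divnMDl // addnC.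
Qed.

(** Slot 1 is the program counter (counter [i] of the simulated program being
    [i + 5]), slot 2 a guess incremented at any time by [tick], slot 3 its
    triangular number, slot 4 the guessed parameter and slot [r + 5] register
    [r].  A single guarded transition thus computes a Cantor pairing. *)
Definition jump (i : nat) (gs : seq (slots * slots)) (u : seq (nat * slots)) (j : nat) : trans :=
  (([:: 1], nseq i 0) :: gs, [:: (1, nseq j 0); (2, [::]); (3, [::])] ++ u).

(** Both updates read the old guess [g]: slot 3 grows by [g + 1], from [tri g] to [tri g.+1]. *)
Definition tick : trans := ([::], [:: (2, [:: 2; 0]); (3, [:: 3; 2; 0])]).

(** A decrement needs no subtraction: the guard forces register = guess + 1, and the guess is
    stored. *)
Definition instr_trans (i : nat) (c : instr) : seq trans :=
  match c with
  | Inc r => [:: jump i.+1.+4 [::] [:: (r.+1.+4, [:: r.+1.+4; 0])] i.+2.+4]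
  | Dec r j => [:: jump i.+1.+4 [:: ([:: r.+1.+4], [::])] [::] j.+1.+4;
                   jump i.+1.+4 [:: ([:: r.+1.+4], [:: 2; 0])] [:: (r.+1.+4, [:: 2])] i.+2.+4]
  end.

Definition instr_reg (c : instr) : nat := match c with Inc r => r | Dec r _ => r end.

(** The base value 1 keeps register 0, which holds input and output, in range. *)
Definition reg_bound (P : program) : nat := foldr (fun c b => maxn (instr_reg c).+1 b) 1 P.

Lemma reg_bound_gt0 P : 0 < reg_bound P.
Proof. by elim: P => //= c P IH; rewrite leq_max IH orbT. Qed.

Lemma nth_reg_bound P i : instr_reg (nth (Inc 0) P i) < reg_bound P.
Proof.
elim: P i => [|c P IH] [|i] //=; first by rewrite leq_max ltnSn.
by rewrite leq_max IH orbT.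
Qed.

Section Simulation.

Variables (K d : nat) (P : program).

(** Phase 0 stores the guess as the parameter. Phases 1 to 4 build the instance code in register 0
    from the inside out: each forces the guess to be [x + y] and writes [tri (x + y) + y]. The extra
    slots 0 supply the constants and the successors from [code_list]. *)
Definition setup_trans : seq trans :=
  [:: jump 0 [::] [:: (4, [:: 2])] 1;
      jump 1 [:: ([:: 2], [:: 4; 4; 0; 0])] [:: (5, [:: 3; 0; 0])] 2;
      jump 2 [:: ([:: 2], 5 :: nseq K 0)] [:: (5, 3 :: nseq K 0)] 3;
      jump 3 [:: ([:: 2], [:: 5; 0; 4])] [:: (5, [:: 3; 4])] 4;
      jump 4 [:: ([:: 2], [:: 5, 0 & nseq d 0])] [:: (5, [:: 3; 5; 0])] 5].

Definition program_trans : seq trans :=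
  flatten [seq instr_trans i (nth (Inc 0) P i) | i <- iota 0 (size P)].

Definition machine : seq trans := tick :: setup_trans ++ program_trans.

(** The guess serves as slack, turning the inequality [size P + 5 <=] slot 1 into an equation; slot
    5 must hold the answer 0. *)
Definition halt_guards : seq (slots * slots) :=
  [:: ([:: 1], 2 :: nseq (size P).+1.+4 0); ([:: 5], [::])].

Definition setup1 n := cpair n.*2 2.
Definition setup2 n := cpair (setup1 n) K.
Definition setup3 n := cpair (setup2 n).+1 n.
Definition setup_code n := cpair d (setup3 n).+1.

(** * Invariant of reachable states, and soundness of the simulation *)

Definition models (f : nat -> nat) (p n : nat) (rho : nat -> nat) : Prop :=
  [/\ f 0 = 1, f 1 = p, f 3 = tri (f 2), f 4 = n
    & forall r, r < reg_bound P -> f r.+1.+4 = rho r].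

Definition legal (p n : nat) (rho : nat -> nat) : Prop :=
  match p with
  | 0 | 1 => rho = regs (init_config 0)
  | 2 => rho = regs (init_config (setup1 n))
  | 3 => rho = regs (init_config (setup2 n))
  | 4 => rho = regs (init_config (setup3 n))
  | p.+1.+4 => exists t, iter t (step' P) (init_config (setup_code n)) = Config p rho
  end.

Lemma ev_nseq0 f i : f 0 = 1 -> ev f (nseq i 0) = i.
Proof. by move=> f0; rewrite /ev map_nseq sumn_nseq f0 mul1n. Qed.

Lemma ev_cons f a l : ev f (a :: l) = f a + ev f l. Proof. by []. Qed.
Lemma ev_nil f : ev f [::] = 0. Proof. by []. Qed.

Lemma init_regE a r : regs (init_config a) r = if r == 0 then a else 0.
Proof. by []. Qed.

Lemma models_init : models start_state 0 0 (regs (init_config 0)).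
Proof. by split=> // r _; rewrite /= if_same. Qed.

Lemma models_tick f p n rho : models f p n rho -> models (exec tick.2 f) p n rho.
Proof.
case=> f0 f1 f3 f4 fr; split=> [|||| r rR]; rewrite /exec /= ?(ev_cons, ev_nil) ?addn0 //.
  by rewrite f0 f3 !addn1 triS.
exact: fr.
Qed.

Lemma guard_jump f i gs u j : f 0 = 1 ->
  guard_ok (jump i gs u j).1 f = (f 1 == i) && guard_ok gs f.
Proof. by move=> f0; rewrite /guard_ok /= !(ev_cons, ev_nil) ev_nseq0 ?addn0. Qed.

Lemma models_guess f p n rho :
  models f p n rho -> models (exec (jump 0 [::] [:: (4, [:: 2])] 1).2 f) 1 (f 2) rho.
Proof.
case=> f0 f1 f3 f4 fr; split=> [|||| r rR];
  rewrite /exec /= ?(ev_cons, ev_nil) ?f0 ?addn0 //; exact: fr.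
Qed.

Lemma models_pair f p n a l l' x y i gs j :
  models f p n (regs (init_config a)) ->
  ev f [:: 2] = ev f l -> ev f l = x + y -> ev f l' = y ->
  models (exec (jump i gs [:: (5, 3 :: l')] j).2 f) j n (regs (init_config (cpair x y))).
Proof.
rewrite {1}/ev /= addn0.
case=> f0 f1 f3 f4 fr f2 lE l'E; split=> [|||| [|r] rR];
  rewrite /exec /= ?(ev_cons, ev_nil) ?ev_nseq0 ?addn0 //; last by rewrite fr.
by rewrite l'E f3 f2 lE.
Qed.

Lemma models_instr_jump f p n rho i gs j : models f p n rho ->
  models (exec (jump i gs [::] j).2 f) j n rho.
Proof.
case=> f0 f1 f3 f4 fr; split=> [|||| r rR];
  rewrite /exec /= ?(ev_cons, ev_nil) ?ev_nseq0 ?addn0 //; exact: fr.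
Qed.

Lemma models_instr_set f p n rho i gs j q l v : models f p n rho -> ev f l = v ->
  models (exec (jump i gs [:: (q.+1.+4, l)] j).2 f) j n (upd rho q v).
Proof.
case=> f0 f1 f3 f4 fr lE; split=> [|||| r rR];
  rewrite /exec /= ?(ev_cons, ev_nil) ?ev_nseq0 ?addn0 //.
rewrite !eqSS /upd eq_sym.
by case: ifP => // _; rewrite !(ev_cons, ev_nil) addn0 fr.
Qed.

Lemma setup_evals f p n a : models f p n (regs (init_config a)) ->
  [/\ ev f [:: 4; 4; 0; 0] = n.*2 + 2 /\ ev f [:: 0; 0] = 2,
      ev f (5 :: nseq K 0) = a + K /\ ev f (nseq K 0) = K,
      ev f [:: 5; 0; 4] = a.+1 + n /\ ev f [:: 4] = n
    & ev f [:: 5, 0 & nseq d 0] = d + a.+1 /\ ev f [:: 5; 0] = a.+1].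
Proof.
case=> f0 f1 f3 f4 fr; have f5 := fr 0 (reg_bound_gt0 P).
rewrite !(ev_cons, ev_nil) !ev_nseq0 // f0 f4 f5 !addn0 !init_regE /= -addnn.
split; split=> //; rewrite ?addn1 ?addnA ?addn1 //.
by rewrite addnC.
Qed.

Lemma legal_setup f p n rho t : models f p n rho -> legal p n rho ->
  t \in setup_trans -> guard_ok t.1 f ->
  exists p' n' rho', models (exec t.2 f) p' n' rho' /\ legal p' n' rho'.
Proof.
move=> mf; have [f0 f1 _ _ _] := mf.
rewrite !inE => lp /or4P[/eqP->|/eqP->|/eqP->|/orP[]/eqP->];
  rewrite guard_jump // f1 => /andP[/eqP pE]; rewrite /guard_ok /= ?andbT;
  [move=> _|move=> /eqP kE ..];
  rewrite pE /= in lp; subst rho.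
- by exists 1, (f 2); eexists; split; [apply: models_guess mf|].
- have [[e1 e2] _ _ _] := setup_evals mf.
  (* [0] and [[::]] stand for the source phase and the guards, on which the update part of a jump
     does not depend. *)
  by exists 2, n; eexists; split; [apply: (models_pair 0 [::] 2) mf kE e1 e2|].
- have [_ [e1 e2] _ _] := setup_evals mf.
  by exists 3, n; eexists; split; [apply: (models_pair 0 [::] 3) mf kE e1 e2|].
- have [_ _ [e1 e2] _] := setup_evals mf.
  by exists 4, n; eexists; split; [apply: (models_pair 0 [::] 4) mf kE e1 e2|].
- have [_ _ _ [e1 e2]] := setup_evals mf.
  by exists 5, n; eexists; split; [apply: (models_pair 0 [::] 5) mf kE e1 e2|exists 0].
Qed.

Lemma mem_program_trans t : t \in program_trans ->
  exists2 i, i < size P & t \in instr_trans i (nth (Inc 0) P i).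
Proof.
by case/flatten_mapP=> i; rewrite mem_iota add0n => iP tP; exists i.
Qed.

Lemma step'_lt p rho : p < size P -> step' P (Config p rho) = step P (Config p rho).
Proof. by move=> pP; rewrite /step' /halted /= leqNgt pP. Qed.

Lemma legal_program f p n rho t : models f p n rho -> legal p n rho ->
  t \in program_trans -> guard_ok t.1 f ->
  exists p' n' rho', models (exec t.2 f) p' n' rho' /\ legal p' n' rho'.
Proof.
move=> mf lp /mem_program_trans[i iP].
have := nth_reg_bound P i; have := step'_lt _ iP; rewrite {1}/step /=.
have [f0 f1 _ _ fr] := mf.
case: (nth _ _ _) => [r|r j] stepE /= rR; rewrite !inE.
  move=> /eqP->; rewrite guard_jump // f1 => /andP[/eqP pE _].
  rewrite pE /= in lp; have [s sE] := lp.
  exists i.+2.+4, n, (upd rho r (rho r).+1); split; last first.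
    by exists s.+1; rewrite iterS sE stepE.
  by apply: (models_instr_set 0 [::] i.+2.+4 r mf); rewrite !(ev_cons, ev_nil) fr // f0 addn1.
case/orP=> /eqP->; rewrite guard_jump // f1 => /andP[/eqP pE];
  rewrite /guard_ok /= andbT !(ev_cons, ev_nil) fr // ?f0 addn0 => /eqP rE;
  rewrite pE /= in lp; have [s sE] := lp.
  exists j.+1.+4, n, rho; split; first exact: (models_instr_jump 0 [::] j.+1.+4 mf).
  by exists s.+1; rewrite iterS sE stepE rE.
(* The guard gave [rho r = f 2 + 1], so the stored guess is the predecessor. *)
exists i.+2.+4, n, (upd rho r (rho r).-1); split; last first.
  by exists s.+1; rewrite iterS sE stepE rE addn1.
by apply: (models_instr_set 0 [::] i.+2.+4 r mf); rewrite !(ev_cons, ev_nil) rE addn0 addn1.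
Qed.

Lemma reach_legal f : reach machine f ->
  exists p n rho, models f p n rho /\ legal p n rho.
Proof.
elim=> [|{}f t _ [p [n [rho [mf lp]]]]].
  by exists 0, 0, (regs (init_config 0)); split=> //; apply: models_init.
rewrite inE mem_cat => /or3P[/eqP-> _|tt tg|tt tg].
- by exists p, n, rho; split=> //; apply: models_tick.
- exact: legal_setup mf lp tt tg.
- exact: legal_program mf lp tt tg.
Qed.

Lemma reach_halt_sound f : reach machine f -> guard_ok halt_guards f ->
  halts_with P (setup_code (f 4)) 0.
Proof.
move=> /reach_legal[p [n [rho [[f0 f1 _ f4 fr] lp]]]].
rewrite /guard_ok /halt_guards /all /fst /snd andbT !(ev_cons, ev_nil).
(* This puts the phase in the form [_.+1.+4], on which [legal] reduces to a run of [P]. *)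
rewrite ev_nseq0 // f1 f0 !addn0 addnC !(add1n, addSn) => /andP[/eqP pE /eqP r0].
rewrite pE /= in lp; have [s sE] := lp.
exists s; rewrite f4 sE /halted /= leq_addr; split=> //.
by rewrite -fr // reg_bound_gt0.
Qed.

(** * Completeness of the simulation *)

(** Ticks are unguarded, so the guess can be raised from 0 to any value before the next jump. *)
Lemma reach_ready f p n rho k : reach machine f -> models f p n rho -> f 2 = 0 ->
  exists f', [/\ reach machine f', models f' p n rho & f' 2 = k].
Proof.
move=> rf mf f2; elim: k => [|k [f' [rf' mf' f'2]]]; first by exists f.
exists (exec tick.2 f'); split; last 1 first.
- by rewrite /exec /= !(ev_cons, ev_nil) f'2; case: mf' => -> *; rewrite addn0 addn1.
- by apply: reach_step => //; apply: mem_head.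
- exact: models_tick.
Qed.

Definition ready p n rho := exists f, [/\ reach machine f, models f p n rho & f 2 = 0].

Lemma reach_jump f i gs u j : reach machine f -> f 0 = 1 -> f 1 = i ->
  jump i gs u j \in setup_trans ++ program_trans -> guard_ok gs f ->
  reach machine (exec (jump i gs u j).2 f).
Proof.
move=> rf f0 f1 tin gok; apply: reach_step rf _ _; first by rewrite in_cons tin orbT.
by rewrite guard_jump // f1 eqxx.
Qed.

Lemma ready_pair i n a l l' x y j :
  jump i [:: ([:: 2], l)] [:: (5, 3 :: l')] j \in setup_trans ->
  (forall f, models f i n (regs (init_config a)) -> ev f l = x + y /\ ev f l' = y) ->
  ready i n (regs (init_config a)) -> ready j n (regs (init_config (cpair x y))).
Proof.
move=> tin lE [f [rf mf f2]]; have [f' [rf' mf' f'2]] := reach_ready (x + y) rf mf f2.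
have [e1 e2] := lE _ mf'; have [f0 f1 _ _ _] := mf'.
have g : ev f' [:: 2] = ev f' l by rewrite e1 -f'2 /ev /= addn0.
exists (exec (jump i [:: ([:: 2], l)] [:: (5, 3 :: l')] j).2 f'); split=> //.
  by apply: reach_jump => //; rewrite ?mem_cat ?tin // /guard_ok /= g eqxx.
exact: models_pair mf' g e1 e2.
Qed.

Lemma ready_setup n : ready 5 n (regs (init_config (setup_code n))).
Proof.
have [|f [rf mf f2]] := @reach_ready start_state _ _ _ n (reach_start _) models_init.
  by [].
have r1 : ready 1 n (regs (init_config 0)).
  exists (exec (jump 0 [::] [:: (4, [:: 2])] 1).2 f); split=> //.
    by have [f0 f1 _ _ _] := mf; apply: reach_jump => //; rewrite mem_head.
  by rewrite -f2; apply: models_guess mf.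
(* The pairings are peeled off from the last phase back to the first. *)
apply: (ready_pair (i := 4) (a := setup3 n) (l := [:: 5, 0 & nseq d 0]) (l' := [:: 5; 0])).
- by rewrite !inE eqxx !orbT.
- by move=> g mg; have [_ _ _] := setup_evals mg.
apply: (ready_pair (i := 3) (a := setup2 n) (l := [:: 5; 0; 4]) (l' := [:: 4])).
- by rewrite !inE eqxx !orbT.
- by move=> g mg; have [_ _] := setup_evals mg.
apply: (ready_pair (i := 2) (a := setup1 n) (l := 5 :: nseq K 0) (l' := nseq K 0)).
- by rewrite !inE eqxx !orbT.
- by move=> g mg; have [_] := setup_evals mg.
apply: (ready_pair (i := 1) (a := 0) (l := [:: 4; 4; 0; 0]) (l' := [:: 0; 0])) r1.
- by rewrite !inE eqxx !orbT.
- by move=> g mg; have [] := setup_evals mg.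
Qed.

Lemma instr_trans_in i t : i < size P -> t \in instr_trans i (nth (Inc 0) P i) ->
  t \in setup_trans ++ program_trans.
Proof.
move=> iP tin; rewrite mem_cat; apply/orP; right.
by apply/flatten_mapP; exists i; rewrite // mem_iota add0n.
Qed.

Lemma ready_step n c : ready (pc c).+1.+4 n (regs c) ->
  ready (pc (step' P c)).+1.+4 n (regs (step' P c)).
Proof.
case: c => i rho /= [f [rf mf f2]]; rewrite /step' /halted /=.
case: leqP => [_|iP]; first by exists f.
have tin := instr_trans_in iP; have rR := nth_reg_bound P i; rewrite /step /=.
case: (nth _ _ _) tin rR => [r|r j] /= tin rR.
  have [f0 f1 _ _ fr] := mf.
  exists (exec (jump i.+1.+4 [::] [:: (r.+1.+4, [:: r.+1.+4; 0])] i.+2.+4).2 f).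
  split=> //; first by apply: reach_jump => //; apply: tin; rewrite mem_head.
  by apply: models_instr_set mf _; rewrite !(ev_cons, ev_nil) fr // f0 addn1.
have [r0|r0] := eqVneq (rho r) 0.
  have [f0 f1 _ _ fr] := mf.
  exists (exec (jump i.+1.+4 [:: ([:: r.+1.+4], [::])] [::] j.+1.+4).2 f).
  split=> //; last exact: models_instr_jump mf.
  apply: reach_jump => //; first by apply: tin; rewrite mem_head.
  by rewrite /guard_ok /= !(ev_cons, ev_nil) fr // r0.
have [f' [rf' mf' f'2]] := reach_ready (rho r).-1 rf mf f2.
have [f0 f1 _ _ fr] := mf'.
exists (exec (jump i.+1.+4 [:: ([:: r.+1.+4], [:: 2; 0])] [:: (r.+1.+4, [:: 2])] i.+2.+4).2 f').
split=> //; last by apply: models_instr_set mf' _; rewrite !(ev_cons, ev_nil) f'2 addn0.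
apply: reach_jump => //; first by apply: tin; rewrite !inE eqxx orbT.
by rewrite /guard_ok /= !(ev_cons, ev_nil) fr // f'2 f0 !addn0 addn1 prednK ?lt0n ?eqxx.
Qed.

Lemma reach_halt_complete n : halts_with P (setup_code n) 0 ->
  exists f, [/\ reach machine f, guard_ok halt_guards f & f 4 = n].
Proof.
case=> s [hs r0]; set c := iter s _ _ in hs r0.
have [f [rf mf f2]] : ready (pc c).+1.+4 n (regs c).
  rewrite /c; elim: s {c hs r0} => [|s IH]; first exact: ready_setup.
  exact: ready_step.
(* The guess is raised to the slack required by [halt_guards]. *)
have [f' [rf' mf' f'2]] := reach_ready (pc c - size P) rf mf f2.
have [f0 f1 _ f4 fr] := mf'.
exists f'; split=> //; rewrite /guard_ok /halt_guards /all /fst /snd andbT.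
rewrite !(ev_cons, ev_nil) ev_nseq0 // f1 f'2 (fr 0) ?reg_bound_gt0 // r0 !addn0.
by rewrite f0 !(add1n, addnS) subnK // !eqxx.
Qed.

(** * Slot bounds for the machine *)

Lemma slot_small i : i < 6 -> i < reg_bound P + 5.
Proof. by move=> i6; apply: leq_trans i6 _; rewrite -(add1n 5) leq_add2r reg_bound_gt0. Qed.

Lemma bounded_cons D a l : bounded D (a :: l) = (a < D) && bounded D l.
Proof. by []. Qed.

Lemma bounded_nseq0 k : bounded (reg_bound P + 5) (nseq k 0).
Proof. by rewrite /bounded all_nseq slot_small // orbT. Qed.

Lemma wf_jump i gs u j : wf_guards (reg_bound P + 5) gs ->
  all (fun p => bounded (reg_bound P + 5) p.2) u ->
  wf_trans (reg_bound P + 5) (jump i gs u j).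
Proof.
move=> gW uW; rewrite /wf_trans /jump /wf_guards /fst /snd /=.
by rewrite -/(wf_guards _ gs) gW uW !bounded_nseq0 /bounded /= !slot_small.
Qed.

Lemma machine_wf : all (wf_trans (reg_bound P + 5)) machine.
Proof.
apply/allP=> t; rewrite in_cons mem_cat => /or3P[/eqP->||/mem_program_trans[i _]].
- by rewrite /wf_trans /= !bounded_cons !slot_small.
- rewrite !inE => /or4P[/eqP->|/eqP->|/eqP->|/orP[]/eqP->];
    by apply: wf_jump; rewrite /wf_guards /= ?andbT ?bounded_cons ?bounded_nseq0 ?slot_small.
have := nth_reg_bound P i.
case: (nth _ _ _) => [r|r j] /= rR; rewrite !inE;
  have rS : r.+1.+4 < reg_bound P + 5 by rewrite !addnS addn0 !ltnS.
- by move/eqP->; apply: wf_jump => //; rewrite /= !bounded_cons rS !slot_small.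
- by case/orP=> /eqP->; apply: wf_jump; rewrite /wf_guards //= !bounded_cons ?rS ?slot_small.
Qed.

Lemma halt_guards_wf : wf_guards (reg_bound P + 5) halt_guards.
Proof.
rewrite /wf_guards /halt_guards /all /fst /snd !bounded_cons.
by rewrite !slot_small // bounded_nseq0.
Qed.

End Simulation.

(** * Self-reference and the contradiction *)

(** Halted configurations are fixed by [step'], so the later of two halting times sees the
    configuration of the earlier. *)
Lemma halts_with_inj P a o o' : halts_with P a o -> halts_with P a o' -> o = o'.
Proof.
have stable c s : halted P c -> iter s (step' P) c = c.
  by move=> hc; elim: s => //= s ->; rewrite /step' hc.
case=> s [hs <-] [s' [hs' <-]].
case/orP: (leq_total s s') => le.
  by rewrite -[in RHS](subnK le) iterD (stable _ _ hs).
by rewrite -[in LHS](subnK le) iterD (stable _ _ hs').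
Qed.

Lemma reach_slot0 K d P f : reach (machine K d P) f -> f 0 = 1.
Proof. by case/reach_legal=> p [n [rho [[]]]]. Qed.

Theorem mainTheorem10 :
  undecidable code_instance valid_instance semigroup_has_nonneg.
Proof.
move=> P decP.
(* [D'.+1] counts the five reserved slots and the registers of [P]. Thus [d] and [K] depend on [P]
   alone and can be built into the machine without circularity. *)
pose D' := (reg_bound P + 4)%N.
pose d := (4 + D'.+1 * D'.+1)%N.
pose K := start_tail D'.
pose ts := machine K d P.
pose gs := halt_guards P.
pose n := code_list (map (@code_mx d) (machine_mxs D' ts gs)).
pose x : instance := existT _ d (start_mx D' n :: machine_mxs D' ts gs).
have xE : code_instance x = setup_code K d n.
  by rewrite /code_instance /x /= code_start_mx.
have D'E : D'.+1 = (reg_bound P + 5)%N by rewrite [RHS]addnS.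
have tsW : all (wf_trans D'.+1) ts by rewrite D'E machine_wf.
have gsW : wf_guards D'.+1 gs by rewrite D'E halt_guards_wf.
(* The list contains the final matrix, and a nonempty list has a successor as code. *)
have n0 : 0 < n by rewrite /n /machine_mxs; case: (map _ ts).
have D5 : 4 < D'.+1 by rewrite D'E addnC leq_addr.
have QE : semigroup_has_nonneg x <-> halts_with P (code_instance x) 0.
  rewrite xE; apply: (iff_trans (semigroup_has_nonneg_accepts tsW gsW n0 D5)).
  split=> [[f [rf gf]]|/reach_halt_complete[f [rf gf fn]]].
    rewrite (reach_slot0 rf) mul1n => <-; exact: reach_halt_sound rf gf.
  by exists f; split=> //; rewrite (reach_slot0 rf) mul1n.
have [yes no] := decP x isT.
(* A positive instance would make [P] answer both 1 and 0; a negative one makes it answer 0, hence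
   is positive. *)
have nQ : ~ semigroup_has_nonneg x.
  by move=> Q; have := halts_with_inj (yes Q) (QE.1 Q).
exact: nQ (QE.2 (no nQ)).
Qed.
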